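(* Let $d\ge 1$, $i>0$ and $0\le j\le d-i$. Then $[x^k]C_{d,i,j}(x)=[x^{d+1-k}]C_{d,i,d-i-j}(x)$ for all $0\le k\le d+1$.
   Context: For $j\ge 0$ let $g(L_j,x)=\sum_{m=0}^{\lfloor j/2\rfloor}\frac{1}{j-m+1}\binom{j}{m}\binom{2j-2m}{j}(x-1)^m$. For $1\le k\le d$ let $Q_{d,k}(x)=\sum_{j=k-1}^{d}2^{d-j}\left[\binom{d-k}{d-j}+\binom{d+1-k}{d-j}\right](x-1)^{d-j}g(L_j,x)$. For $i>0$ and $0\le j\le d-i$ define $C_{d,i,j}(x)=\sum_{k=j+1}^{i+j}2^{-i}\binom{i-1}{k-1-j}Q_{d,k}(x)$. $[x^k]p(x)$ denotes the coefficient of $x^k$ in $p(x)$. *)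

(* Defs.v *)
From mathcomp Require Import all_boot all_order all_algebra.

Set Implicit Arguments.
Unset Strict Implicit.
Unset Printing Implicit Defensive.

Import GRing.Theory.
Local Open Scope ring_scope.

Definition gL (j : nat) : {poly rat} :=
  \sum_(0 <= m < (j./2).+1)
    ((j - m + 1)%N%:R^-1 * 'C(j, m)%:R * 'C(2 * j - 2 * m, j)%:R)
      *: ('X - 1) ^+ m.

(* Meant for 1 <= k <= d: the truncated subtractions below are then exact. *)
Definition Q (d k : nat) : {poly rat} :=
  \sum_(k - 1 <= j < d.+1)
    (2 ^+ (d - j) * ('C(d - k, d - j)%:R + 'C(d + 1 - k, d - j)%:R))
      *: (('X - 1) ^+ (d - j) * gL j).

(* Meant for 0 < i and i + j <= d. *)
Definition C (d i j : nat) : {poly rat} :=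
  \sum_(j + 1 <= k < (i + j).+1)
    (2 ^- i * 'C(i - 1, k - 1 - j)%:R) *: Q d k.

(* Main.v *)
(** Write y = x - 1 and think of g(L_j) as the value of a linear functional at
    the umbral power g^j.  Then
      Q_{d,k} = 2 (g + y) (g + 2y)^(d-k) g^(k-1),
    so with h = g + y it becomes 2 h (h + y)^(d-k) (h - y)^(k-1).  The value h_j
    of the functional at h^j is, by Vandermonde, sum_n Cat_n C(j+n,2n) y^(j-n),
    which is the Narayana polynomial; for j > 0 it is therefore symmetric:
    x^(j+1) h_j(1/x) = h_j(x).  Since x -> 1/x turns y into -y/x, it exchanges
    the factors h + y and h - y, so x^(d+1) Q_{d,k}(1/x) = Q_{d,d+1-k}(x).
    Reversing the sum defining C_{d,i,j} gives the claim. *)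

Require Import Defs.
From mathcomp Require Import all_boot all_order all_algebra.
From mathcomp Require Import zify ring.

Import GRing.Theory Num.Theory.
Local Open Scope ring_scope.

(** * Binomial identities *)

Lemma bin_trinomial n m k : (k <= m <= n)%N ->
  ('C(n, m) * 'C(m, k) = 'C(n, k) * 'C(n - k, m - k))%N.
Proof.
move=> /andP[km mn].
have f0 : (0 < k`! * (m - k)`! * (n - m)`!)%N by rewrite !muln_gt0 !fact_gt0.
apply/eqP; rewrite -(eqn_pmul2r f0); apply/eqP.
have e1 := bin_fact mn; have e2 := bin_fact km.
have e3 := bin_fact (leq_trans km mn).
have e4 : ('C(n - k, m - k) * ((m - k)`! * (n - m)`!) = (n - k)`!)%N.
  by rewrite -(@bin_fact (n - k) (m - k)) ?leq_sub2r //; congr (_ * (_ * _`!))%N; lia.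
transitivity n`!; first by rewrite -e1 -e2; ring.
by rewrite -e3 -e4; ring.
Qed.

(** Vandermonde, once ['C(j, l)] is read as ['C(j, j - l)]: the lower indices then add up to
    [j - n]. *)
Lemma sum_bin_shift j n : (n <= j)%N ->
  (\sum_(l < j.+1 | n <= l) 'C(j, l) * 'C(n, l - n) = 'C(j + n, n + n))%N.
Proof.
move=> nj.
rewrite -(@big_geq_mkord _ _ _ n j.+1 xpredT (fun l => 'C(j, l) * 'C(n, l - n))%N).
rewrite -{1}[n]add0n big_addn subSn // big_mkord.
have -> : 'C(j + n, n + n) = 'C(n + j, j - n).
  by rewrite -bin_sub ?leq_add2r // addnC subnDl.
rewrite -binomial.Vandermonde; apply: eq_bigr => a _.
have aj := ltn_ord a.
rewrite addnK mulnC -[in 'C(j, a + n)]bin_sub; last by lia.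
by congr (_ * 'C(_, _))%N; lia.
Qed.

(** Trinomial revision turns ['C(j, k.+1) * 'C(k.+1, m)] into ['C(j, m) * 'C(j - m, j.-1 - k)], so
    that Vandermonde applies. *)
Lemma sum_bin_narayana j m : (0 < j)%N -> (m <= j)%N ->
  (\sum_(k < j) 'C(j, k) * 'C(j, k.+1) * 'C(k.+1, m)
    = 'C(j, m) * 'C(j + (j - m), j.-1))%N.
Proof.
case: j => // j _ mj.
rewrite -binomial.Vandermonde big_distrr /=; apply: eq_bigr => k _.
have kj := ltn_ord k.
rewrite -mulnA [RHS]mulnCA; congr (_ * _)%N.
have [mk|km] := leqP m k.+1; last first.
  by rewrite (@bin_small k.+1 m) // (@bin_small _ (j - k)) ?muln0 //; lia.
rewrite bin_trinomial ?mk //; congr (_ * _)%N.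
by rewrite -bin_sub; [congr 'C(_, _); lia | lia].
Qed.

Lemma catalan_bin j n : (0 < j)%N -> (n <= j)%N ->
  (j * ('C(n + n, n) * 'C(j + n, n + n)) = n.+1 * ('C(j, j - n) * 'C(j + n, j.-1)))%N.
Proof.
move=> j0 nj.
rewrite [('C(n + n, n) * _)%N]mulnC bin_trinomial ?leq_addl ?leq_add2r //.
have := mul_bin_left (j + n) n; rewrite !addnK bin_sub // mulnA => <-.
rewrite -mulnA [('C(_, n.+1) * _)%N]mulnC; congr (_ * (_ * _))%N.
by rewrite -bin_sub; [congr 'C(_, _); lia | lia].
Qed.

(** * Umbral powers as Narayana polynomials *)

Definition catalan (n : nat) : rat := n.+1%:R^-1 * 'C(n + n, n)%:R.

Local Notation Y := ('X - 1 : {poly rat}).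

(** Put [n = l - m] and apply trinomial revision. The range up to [j], independent of [l], prepares
    an exchange of sums. *)
Lemma gL_catalan j l : (l <= j)%N ->
  gL l = \sum_(n < j.+1 | (n <= l)%N) (catalan n * 'C(n, l - n)%:R) *: Y ^+ (l - n).
Proof.
move=> lj; rewrite /gL.
(* The terms beyond [l./2] vanish, since there [2 * l - 2 * m < l]. *)
transitivity (\sum_(0 <= m < l.+1)
   ((l - m + 1)%N%:R^-1 * 'C(l, m)%:R * 'C(2 * l - 2 * m, l)%:R) *: Y ^+ m).
  rewrite [RHS](@big_cat_nat _ _ _ (l./2).+1) //=; last by lia.
  rewrite [X in _ = _ + X]big_nat_cond [X in _ = _ + X]big1 ?addr0 // => m.
  rewrite andbT => h; rewrite (@bin_small _ l) ?mulr0 ?scale0r //; lia.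
rewrite big_mkord (reindex_inj rev_ord_inj) /=.
rewrite -(@big_ord_widen _ _ _ l.+1 j.+1
  (fun n => (catalan n * 'C(n, l - n)%:R) *: Y ^+ (l - n))) //.
apply: eq_bigr => n _; have nl : (n <= l)%N by rewrite -ltnS.
rewrite subSS.
congr (_ *: _); rewrite /catalan subKn // addn1 -!mulrA; congr (_ * _).
rewrite -!natrM; congr (_%:R).
have [h|h] := ltnP n (l - n).
  by rewrite (@bin_small n) // (@bin_small _ l) ?muln0 //; lia.
have -> : (2 * l - 2 * (l - n) = n + n)%N by lia.
by rewrite mulnC bin_sub // bin_trinomial ?addnK //; lia.
Qed.

(* The umbral power (g + y)^j. *)
Definition hL (j : nat) : {poly rat} :=
  \sum_(l < j.+1) 'C(j, l)%:R *: (Y ^+ (j - l) * gL l).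

Lemma hL_catalan j :
  hL j = \sum_(n < j.+1) (catalan n * 'C(j + n, n + n)%:R) *: Y ^+ (j - n).
Proof.
rewrite /hL.
under eq_bigr => l _.
  rewrite (@gL_catalan j) -1?ltnS // big_mkcond mulr_sumr scaler_sumr /=.
  over.
rewrite exchange_big /=; apply: eq_bigr => n _.
rewrite -sum_bin_shift -1?ltnS // natr_sum mulr_sumr scaler_suml.
rewrite [RHS]big_mkcond; apply: eq_bigr => l _.
case: leqP => [nl|]; last by rewrite mulr0 scaler0.
have lj := ltn_ord l.
rewrite -scalerAr scalerA -exprD natrM mulrCA; congr (_ *: _ ^+ _); lia.
Qed.

(** The coefficients on the right are [j] times the Narayana numbers. Expanding powers of
    ['X = Y + 1] reduces the claim to comparing coefficients of [Y ^+ m]. *)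
Lemma hL_narayana j : (0 < j)%N ->
  j%:R *: hL j = \sum_(k < j) ('C(j, k) * 'C(j, k.+1))%:R *: 'X^(k.+1).
Proof.
move=> j0.
have XE (k : 'I_j) : 'X^(k.+1) = \sum_(m < j.+1) 'C(k.+1, m)%:R *: Y ^+ m.
  rewrite -{1}['X](subrK 1) exprD1n.
  rewrite (big_ord_widen j.+1 (fun m => Y ^+ m *+ 'C(k.+1, m))) ?ltnS //.
  rewrite big_mkcond /=; apply: eq_bigr => m _; rewrite scaler_nat.
  by case: ltnP => // h; rewrite bin_small.
under [RHS]eq_bigr => k _ do rewrite XE scaler_sumr.
rewrite exchange_big /= hL_catalan (reindex_inj rev_ord_inj) /= scaler_sumr.
apply: eq_bigr => m _; have mj : (m <= j)%N by rewrite -ltnS.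
rewrite subSS subKn // scalerA.
under [RHS]eq_bigr => k _ do rewrite scalerA -natrM.
rewrite -scaler_suml -natr_sum sum_bin_narayana //; congr (_ *: _).
have := catalan_bin j (j - m) j0 (leq_subr _ _); rewrite subKn // => e.
by rewrite /catalan -mulrA -natrM mulrCA -natrM e natrM mulKf ?pnatr_eq0.
Qed.

(** * Reciprocal polynomials *)

(** The relation q(x) = x^n p(1/x), expressed through values so as to stay within polynomials. *)
Definition reciprocal (n : nat) (p q : {poly rat}) :=
  (size p <= n.+1)%N /\ forall c : rat, c != 0 -> q.[c] = c ^+ n * p.[c^-1].

Lemma reciprocal_coef n p q k :
  reciprocal n p q -> (k <= n)%N -> p`_k = q`_(n - k).
Proof.
move=> [sp pq] kn.
pose r := \poly_(i < n.+1) p`_(n - i).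
have rE c : c != 0 -> r.[c] = q.[c].
  move=> c0; rewrite pq // (horner_coef_wide _ sp) horner_poly mulr_sumr.
  rewrite (reindex_inj rev_ord_inj) /=; apply: eq_bigr => i _.
  have le_in : (i <= n)%N by rewrite -ltnS.
  rewrite subSS subKn // mulrCA; congr (_ * _).
  have -> : c ^+ n = c ^+ (n - i) * c ^+ i by rewrite -exprD subnK.
  by rewrite exprVn mulfK // expf_neq0.
suff <- : r = q by rewrite coef_poly ltnS leq_subr subKn.
apply/eqP; rewrite -subr_eq0; apply/eqP.
(* The nonzero points 1, 2, ..., [size (r - q)] are more roots than a nonzero [r - q] can have. *)
apply: (@roots_geq_poly_eq0 _ _ [seq i.+1%:R | i <- iota 0 (size (r - q))]).
- apply/allP => _ /mapP[i _ ->].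
  by rewrite /root !hornerE rE ?subrr // pnatr_eq0.
- rewrite map_inj_uniq ?iota_uniq // => x y /eqP.
  by rewrite eqr_nat => /eqP[].
- by rewrite size_map size_iota.
Qed.

(** Replacing [k] by [j - 1 - k] swaps the two binomials of [hL_narayana] and reflects the exponent
    [k.+1] to [j - k]. *)
Lemma hL_reciprocal j : (0 < j)%N -> reciprocal j.+1 (hL j) (hL j).
Proof.
move=> j0; have jn0 : j%:R != 0 :> rat by rewrite pnatr_eq0 -lt0n.
have e := hL_narayana j j0; split.
  rewrite -(size_scale _ jn0) e; apply: leq_trans (size_sum _ _ _) _.
  apply/bigmax_leqP => k _; apply: leq_trans (size_scale_leq _ _) _.
  by rewrite size_polyXn !ltnS ltnW.
move=> c c0; apply: (mulfI jn0).
rewrite [RHS]mulrCA -hornerZ -[_ * (hL j).[c^-1]]hornerZ e !horner_sum mulr_sumr.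
rewrite (reindex_inj rev_ord_inj) /=; apply: eq_bigr => k _.
have kj := ltn_ord k.
rewrite !hornerZ !hornerXn mulrCA subnSK // !bin_sub ?(ltnW kj) // [('C(j, k.+1) * _)%N]mulnC.
congr (_ * _).
have -> : c ^+ j.+1 = c ^+ (j - k) * c ^+ k.+1 by rewrite -exprD; congr (_ ^+ _); lia.
by rewrite exprVn mulfK // expf_neq0.
Qed.

(** * The umbral symbol of [Q] *)

Lemma coef_Xn_X2 n k l : (l <= k + n)%N ->
  ('X^k * ('X + 2%:P) ^+ n : {poly rat})`_l = 2 ^+ (k + n - l) * 'C(n, k + n - l)%:R.
Proof.
move=> lkn; rewrite addrC exprDn coefXnM.
have [lk|kl] := ltnP l k; first by rewrite bin_small ?mulr0 //; lia.
have -> : \sum_(i < n.+1) (2%:P ^+ (n - i) * 'X ^+ i) *+ 'C(n, i)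
        = \poly_(i < n.+1) (2 ^+ (n - i) * 'C(n, i)%:R) :> {poly rat}.
  rewrite poly_def; apply: eq_bigr => i _.
  by rewrite -polyC_exp mul_polyC -scaler_nat scalerA mulrC.
rewrite coef_poly ifT; last by lia.
rewrite -[in 'C(n, _)]bin_sub; last by lia.
by congr (_ ^+ _ * 'C(_, _)%:R); lia.
Qed.

(* [Q d k] as a polynomial in h, dehomogenised by y = 1. *)
Definition Qsymbol (d k : nat) : {poly rat} :=
  2 *: ('X * ('X + 1) ^+ (d - k) * ('X - 1) ^+ (k - 1)).

(** With h = g + 1, the factor 2h = g + (g + 2) splits the product into the two binomial families of
    [Q]. *)
Lemma Qsymbol_comp d k : (0 < k <= d)%N ->
  Qsymbol d k \Po ('X + 1) =
  'X^k * ('X + 2%:P) ^+ (d - k) + 'X^(k - 1) * ('X + 2%:P) ^+ (d + 1 - k).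
Proof.
case: k => // k kd; rewrite /Qsymbol comp_polyZ !rmorphM !rmorphXn /= !rmorphD !rmorphN /=.
rewrite comp_polyX !rmorph1 subn1 /= addn1 subSS exprSr.
have -> : (d - k = (d - k.+1).+1)%N by lia.
rewrite exprSr addrK -addrA -[1 + 1 : {poly rat}]/(2%:R) -polyC_natr -mul_polyC.
ring.
Qed.

Lemma size_Qsymbol d k : (0 < k <= d)%N -> (size (Qsymbol d k) <= d.+1)%N.
Proof.
move=> kd; apply: leq_trans (size_scale_leq _ _) _.
rewrite -['X + 1]/('X + 1%:P) -['X - 1]/('X - 1%:P) -mulrA.
have -> : 'X + 1%:P = 'X - (- 1)%:P :> {poly rat} by rewrite polyCN opprK.
rewrite mulrC size_mulX; last by rewrite mulf_neq0 ?expf_neq0 ?polyXsubC_eq0.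
rewrite size_Mmonic ?expf_neq0 ?polyXsubC_eq0 ?monic_exp ?monicXsubC //.
rewrite !size_exp_XsubC; lia.
Qed.

Lemma coef_comp_NX (p : {poly rat}) i : (p \Po (- 'X))`_i = (-1) ^+ i * p`_i.
Proof.
rewrite comp_polyE.
under eq_bigr => j _ do rewrite -scaleN1r exprZn scalerA.
rewrite -(poly_def (size p) (fun j => p`_j * (-1) ^+ j)) coef_poly mulrC.
by case: ltnP => // h; rewrite nth_default ?mulr0.
Qed.

(** Under h -> -h the factors h + 1 and h - 1 trade places up to sign; the d linear factors give
    (-1)^d in all. *)
Lemma coef_Qsymbol_rev d k i : (0 < k <= d)%N -> (i <= d)%N ->
  (Qsymbol d (d + 1 - k))`_i = (-1) ^+ (d - i) * (Qsymbol d k)`_i.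
Proof.
move=> kd id.
have -> : Qsymbol d (d + 1 - k) = (-1) ^+ d *: (Qsymbol d k \Po (- 'X)).
  rewrite /Qsymbol comp_polyZ !rmorphM !rmorphXn /= !rmorphD !rmorphN /= comp_polyX rmorph1.
  have -> : - 'X + 1 = - ('X - 1) :> {poly rat} by rewrite opprB addrC.
  have -> : - 'X - 1 = - ('X + 1) :> {poly rat} by rewrite opprD.
  rewrite ![(- (_ + _)) ^+ _]exprNn scalerA [_ * 2]mulrC -scalerA; congr (_ *: _).
  have -> : (d - (d + 1 - k) = k - 1)%N by lia.
  have -> : (d + 1 - k - 1 = d - k)%N by lia.
  have -> : (-1) ^+ d = (-1) ^+ (d - k) * (-1) ^+ (k - 1) * (-1) :> rat.
    by rewrite -exprD -exprSr; congr (_ ^+ _); lia.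
  rewrite -mul_polyC !polyCM !polyC_exp !polyCN.
  have sq n : (-1) ^+ n * (-1) ^+ n = 1 :> {poly rat}.
    by rewrite -exprMn mulrNN mulr1 expr1n.
  have := sq (k - 1)%N; have := sq (d - k)%N.
  move: (_ ^+ (d - k)%N) (_ ^+ (k - 1)%N) => a b sa sb.
  transitivity (a * a * (b * b) * ('X * ('X + 1) ^+ (k - 1) * ('X - 1) ^+ (d - k)) : {poly rat}).
    by rewrite sa sb !mul1r.
  ring.
rewrite coefZ coef_comp_NX mulrA -exprD; congr (_ * _).
rewrite -[LHS]signr_odd -[RHS]signr_odd; congr (_ ^+ _); lia.
Qed.

(** Both sides evaluate the degree-n homogenisation of p at h = g + y, expanded in powers of g and
    of h respectively. *)
Lemma sum_gL_hL n (p : {poly rat}) : (size p <= n.+1)%N ->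
  \sum_(l < n.+1) (p \Po ('X + 1))`_l *: (Y ^+ (n - l) * gL l)
  = \sum_(i < n.+1) p`_i *: (Y ^+ (n - i) * hL i).
Proof.
move=> sp.
have cE l : (p \Po ('X + 1))`_l = \sum_(i < n.+1) p`_i * 'C(i, l)%:R.
  rewrite comp_polyE coef_sum (big_ord_widen n.+1 (fun i => (p`_i *: ('X + 1) ^+ i)`_l)) //.
  rewrite big_mkcond /=; apply: eq_bigr => i _.
  case: ltnP => h; last by rewrite nth_default ?mul0r.
  rewrite coefZ exprD1n; congr (_ * _).
  under eq_bigr => m _ do rewrite -scaler_nat.
  rewrite -(poly_def i.+1 (fun m => 'C(i, m)%:R)) coef_poly ltnS.
  by case: leqP => // il; rewrite bin_small.
under eq_bigr => l _ do rewrite cE scaler_suml.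
rewrite exchange_big /=; apply: eq_bigr => i _.
under eq_bigr => l _ do rewrite -scalerA.
rewrite -scaler_sumr /hL mulr_sumr; congr (_ *: _).
rewrite [RHS](big_ord_widen n.+1
  (fun l => Y ^+ (n - i) * ('C(i, l)%:R *: (Y ^+ (i - l) * gL l)))) ?ltn_ord //.
rewrite [RHS]big_mkcond /=; apply: eq_bigr => l _.
case: ltnP => il; last by rewrite bin_small ?scale0r.
rewrite -scalerAr mulrA -exprD; congr (_ *: (_ ^+ _ * _)).
by have := ltn_ord i; lia.
Qed.

(** * Reciprocity of [Q] *)

Lemma Q_hL d k : (0 < k <= d)%N ->
  Q d k = \sum_(i < d.+1) (Qsymbol d k)`_i *: (Y ^+ (d - i) * hL i).
Proof.
move=> kd; rewrite -sum_gL_hL ?size_Qsymbol // Qsymbol_comp // /Q.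
rewrite big_geq_mkord big_mkcond /=; apply: eq_bigr => l _.
have ld := ltn_ord l.
rewrite coefD !coef_Xn_X2; try lia.
have -> : (k + (d - k) = d)%N by lia.
have -> : (k - 1 + (d + 1 - k) = d)%N by lia.
(* Indices [l < k - 1] are absent from [Q]; there [d - l] exceeds both upper indices. *)
case: leqP => h; first by rewrite mulrDr.
by rewrite !bin_small ?mulr0 ?addr0 ?scale0r //; lia.
Qed.

(** Termwise: c - 1 = -c (1/c - 1) yields the sign (-1)^(d-i), which cancels that of
    [coef_Qsymbol_rev]. *)
Lemma Q_reciprocal d k : (0 < k <= d)%N ->
  reciprocal (d + 1) (Q d k) (Q d (d + 1 - k)).
Proof.
move=> kd.
have kd' : (0 < d + 1 - k <= d)%N by lia.
(* The term in [hL 0 = 1] must drop out, as [hL_reciprocal] fails for it. *)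
have Q0 : (Qsymbol d k)`_0 = 0 by rewrite /Qsymbol -mulrA coefZ coefXM mulr0.
rewrite !Q_hL //; split.
  apply: leq_trans (size_sum _ _ _) _.
  apply/bigmax_leqP => -[[|i] /= hi] _; first by rewrite Q0 scale0r size_poly0.
  have [sh _] := hL_reciprocal i.+1 isT.
  apply: leq_trans (size_scale_leq _ _) _; apply: leq_trans (size_polyMleq _ _) _.
  rewrite -['X - 1]/('X - 1%:P) size_exp_XsubC.
  have -> : ((d + 1).+1 = d - i.+1 + i.+3)%N by lia.
  by rewrite addSn leq_add2l.
move=> c c0; rewrite !horner_sum mulr_sumr.
apply: eq_bigr => -[[|i] /= hi] _; rewrite coef_Qsymbol_rev //.
  by rewrite Q0 mulr0 !scale0r !horner0 mulr0.
have [_ hc] := hL_reciprocal i.+1 isT.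
rewrite !hornerE /= hc //.
have -> : c ^+ (d + 1) = c ^+ (d - i.+1) * c ^+ i.+2.
  by rewrite -exprD; congr (_ ^+ _); lia.
have -> : (c - 1) ^+ (d - i.+1) = (-1) ^+ (d - i.+1) * c ^+ (d - i.+1) * (c^-1 - 1) ^+ (d - i.+1).
  by rewrite -!exprMn; congr (_ ^+ _); field.
have : (-1) ^+ (d - i.+1) * (-1) ^+ (d - i.+1) = 1 :> rat.
  by rewrite -exprMn mulrNN mulr1 expr1n.
move: (_ ^+ (d - i.+1)%N) (_ ^+ (d - i.+1)%N) (_ ^+ (d - i.+1)%N) => s x y ss.
by rewrite -[RHS]mul1r -ss; ring.
Qed.

Theorem theorem5p2 (d i j : nat) (hd : (1 <= d)%N) (hi : (0 < i)%N)
    (hij : (i + j <= d)%N) :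
  forall k : nat, (k <= d + 1)%N ->
    (C d i j)`_k = (C d i (d - i - j))`_(d + 1 - k).
Proof.
move=> k kd; rewrite /C !coef_sum.
rewrite -{1}[(j + 1)%N]add0n -[(d - i - j + 1)%N]add0n !big_addn.
have -> : ((i + j).+1 - (j + 1) = i)%N by lia.
have -> : ((i + (d - i - j)).+1 - (d - i - j + 1) = i)%N by lia.
(* With k = t + j + 1 on the left, reversal makes the index on the right d + 1 - k. *)
rewrite !big_mkord [RHS](reindex_inj rev_ord_inj) /=.
apply: eq_bigr => t _; have ti := ltn_ord t.
have kt : (0 < t + (j + 1) <= d)%N by lia.
rewrite !coefZ (reciprocal_coef _ _ _ _ (Q_reciprocal _ _ kt) kd).
have -> : (t + (j + 1) - 1 - j = t)%N by lia.
have -> : (i - t.+1 + (d - i - j + 1) - 1 - (d - i - j) = i - 1 - t)%N by lia.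
by rewrite bin_sub; [congr (_ * (Q _ _)`_ _); lia | lia].
Qed.
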